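(* Let $m\in\{1,2\}$ and let $n$ be a non-negative integer. Then $A_m(n)=C_m(n)$.
   Context: A partition of $n$ is a finite non-increasing sequence $\pi=(\pi_1,\pi_2,\dots,\pi_k)$ of positive integers with $\pi_1+\dots+\pi_k=n$; the empty sequence is the only partition of $0$. The $\pi_i$ are the parts, and $\pi_i$ is said to have index $i$. $C_m(n)$ denotes the number of partitions of $n$ into distinct parts, none of which is congruent to $m$ or $-m$ modulo $6$. $A_m(n)$ denotes the number of partitions $\pi=(\pi_1,\pi_2,\dots)$ of $n$ such that, for every $r\in\{0,1\}$ and every integer $i\ge 0$ with $2i+r\ge 1$ for which the relevant parts exist: (i) $\pi_{2i+r}\not\equiv 3-m+(-1)^m r \pmod 3$, and (ii) $\pi_{2i+r}-\pi_{2i+1+r}>\lfloor m/2\rfloor+(-1)^{m-1}r$. Equivalently: the odd-indexed parts are not congruent to $m$ modulo $3$, the even-indexed parts are not congruent to $3-m$ modulo $3$, all parts are distinct, and $3l+1$ and $3l+2$ never appear together as consecutive parts for any integer $l$. *)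

(* Defs.v *)
From mathcomp Require Import all_boot all_order all_algebra.

Set Implicit Arguments.
Unset Strict Implicit.
Unset Printing Implicit Defensive.

Import Order.TTheory GRing.Theory Num.Theory.

Definition is_partition (n : nat) (s : seq nat) : bool :=
  [&& sorted geq s, 0 \notin s & sumn s == n].

(* A partition of n has at most n parts, each at most n, so the partitions of n
   all live in the finite type {bseq n of 'I_n.+1}; see partition_bseq. *)
Definition num_partitions (n : nat) (P : pred (seq nat)) : nat :=
  #|[set s : {bseq n of 'I_n.+1} |
      is_partition n (map val s) && P (map val s)]|.

(* Parts are indexed from 1: [part s j] is pi_j, meaningful for 1 <= j <= size s. *)
Definition part (s : seq nat) (j : nat) : nat := nth 0 s j.-1.

Definition C_cond (m : nat) (s : seq nat) : bool :=
  uniq s && all (fun x : nat => (x%:Z != m%:Z %[mod 6])%Z &&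
                                (x%:Z != - m%:Z %[mod 6])%Z) s.

Definition A_cond_i (m : nat) (s : seq nat) (r i : nat) : bool :=
  ((part s (2 * i + r))%:Z
     != 3%:Z - m%:Z + (-1) ^+ m * r%:Z %[mod 3])%Z.

Definition A_cond_ii (m : nat) (s : seq nat) (r i : nat) : bool :=
  ((part s (2 * i + r))%:Z - (part s (2 * i + 1 + r))%:Z
     > (m %/ 2)%:Z + (-1) ^+ (m - 1) * r%:Z)%R.

(* The bound i <= size s is implied by 2i + r <= size s; it only makes the
   quantifier finite, see A_condP. *)
Definition A_cond (m : nat) (s : seq nat) : bool :=
  [forall r : 'I_2, forall i : 'I_(size s).+1,
    ((1 <= 2 * i + r <= size s) ==> A_cond_i m s r i) &&
    ((1 <= 2 * i + r) && (2 * i + 1 + r <= size s) ==> A_cond_ii m s r i)].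

Definition A (m n : nat) : nat := num_partitions n (A_cond m).
Definition C (m n : nat) : nat := num_partitions n (C_cond m).

Lemma A_condP (m : nat) (s : seq nat) :
  reflect (forall r i : nat, r < 2 -> 1 <= 2 * i + r ->
             (2 * i + r <= size s -> A_cond_i m s r i) /\
             (2 * i + 1 + r <= size s -> A_cond_ii m s r i))
          (A_cond m s).
Proof.
apply: (iffP idP) => [/forallP H r i r2 ir|H].
  have step : 2 * i + r <= 2 * i + 1 + r by rewrite leq_add2r leq_addr.
  have bnd : 2 * i + r <= size s -> i < (size s).+1.
    by rewrite ltnS; apply: leq_trans; rewrite mul2n -addnn -addnA leq_addr.
  split=> hs.
    have /forallP/(_ (Ordinal (bnd hs)))/andP[/implyP h _] := H (Ordinal r2).
    by apply: h; rewrite /= ir.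
  have /forallP/(_ (Ordinal (bnd (leq_trans step hs))))/andP[_ /implyP h] :=
    H (Ordinal r2).
  by apply: h; rewrite /= ir.
apply/forallP => r; apply/forallP => i.
by apply/andP; split; apply/implyP => /andP[h1 h2];
  have [] := H r i (ltn_ord r) h1; auto.
Qed.

Lemma partition_bseq (n : nat) (s : seq nat) :
  is_partition n s -> exists! t : {bseq n of 'I_n.+1}, map val t = s.
Proof.
case/and3P=> _ s0 /eqP sn.
have szs : size s <= n.
  rewrite -sn {sn}; elim: s s0 => //= x s IH; rewrite in_cons negb_or.
  case/andP; case: x => // x _ /IH h.
  by rewrite addSn ltnS (leq_trans h) // leq_addl.
have bd : all (fun x => x < n.+1) s.
  apply/allP => x; rewrite ltnS -sn {sn s0 szs}; elim: s => //= y s IH.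
  rewrite in_cons => /orP[/eqP -> | /IH h]; first by rewrite leq_addr.
  by rewrite (leq_trans h) // leq_addl.
have st : map val (map (@inord n) s) = s.
  rewrite -map_comp map_id_in // => x xs /=.
  by rewrite inordK //; apply: (allP bd).
have sz : size (map (@inord n) s) <= n by rewrite size_map.
exists (Bseq sz); split => // t ts.
by apply: val_inj; apply: (inj_map val_inj); rewrite /= [RHS]ts.
Qed.

(* Main.v *)
Require Import Defs.
From mathcomp Require Import all_boot all_order all_algebra.
From mathcomp Require Import zify ring.

(** The parts alternate between two classes: those not congruent to 1 modulo 3,
    followed by a gap of more than 1, and those not congruent to 2, followed by
    a positive gap; [m] decides which class comes first. Let [u_N] and [v_N] be
    the generating functions, for [m = 1] and [m = 2], of the admissible
    sequences with parts at most [3 N]. Adding the parts [3 N + 1 .. 3 N + 3]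
    gives
      [u_(N+1) = u_N + q^(3N+2) v_N + q^(3N+3) (v_N + q^(3N+1) u_N)]
    and the same with [u <-> v], [3N+2 <-> 3N+1]. With [x = q^3] and [Q = q^6],
    the q-Pascal rule shows that the solution is
      [u_N = \sum_j [N choose j]_Q (-a; Q)_(N-j) (-c; Q)_j x^j],
    where [a = q^2] and [c = q] (exchanged for [v_N]); this is the finite form,
    due to Ishikawa and Zeng, of Boulet's formula for distinct parts. Modulo
    [q^(n+1)] and for large [N], the q-binomial theorem turns the sum into
    [(-a; Q) (-c x; Q) / (x; x^2)], and [1 / (x; x^2) = (-x; x)] by Euler. The
    result is the generating function of [C m]. Working modulo [q^(n+1)] amounts
    to working in a commutative ring in which [q] is nilpotent. *)

Import GRing.Theory.

Set Implicit Arguments.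
Unset Strict Implicit.
Unset Printing Implicit Defensive.

(** * Gaussian binomials, Pochhammer products and the q-binomial theorem *)

Section QSeries.
Local Open Scope ring_scope.
Variable K : comPzRingType.
Implicit Types a c q x : K.

(* [gbinom q i j] is the Gaussian binomial coefficient "i + j choose j". *)
Fixpoint gbinom q (i : nat) : nat -> K :=
  fix gbinom_i (j : nat) : K :=
  match i, j with
  | i'.+1, j'.+1 => gbinom q i' j + q ^+ i * gbinom_i j'
  | _, _ => 1
  end.

Lemma gbinom0n q j : gbinom q 0 j = 1. Proof. by case: j. Qed.

Lemma gbinomn0 q i : gbinom q i 0 = 1. Proof. by case: i. Qed.

Lemma gbinomSS q i j :
  gbinom q i.+1 j.+1 = gbinom q i j.+1 + q ^+ i.+1 * gbinom q i.+1 j.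
Proof. by []. Qed.

(** A form of the product formula without division, since [1 - q ^+ j.+1] need not be cancellable in
    [K]. *)
Lemma gbinom_ratio q i j :
  (1 - q ^+ j.+1) * gbinom q i j.+1 = (1 - q ^+ i.+1) * gbinom q i.+1 j.
Proof.
elim: i j => [|i IHi] j.
  rewrite gbinom0n mulr1; elim: j => [|j IHj]; first by rewrite gbinomn0 mulr1.
  rewrite gbinomSS gbinom0n mulrDr mulrCA -IHj (exprS q j.+1) !expr1.
  ring.
elim: j => [|j IHj].
  by rewrite gbinomSS mulrDr IHi !gbinomn0 (exprS q i.+1); ring.
rewrite (gbinomSS q i j.+1) mulrDr IHi (gbinomSS q i.+1 j).
rewrite [RHS]mulrDr [X in _ = _ + X]mulrCA -IHj.
by rewrite (exprS q i.+1) (exprS q j.+1); ring.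
Qed.

(** By induction the two sides expand by the two q-Pascal rules, whose difference is
    [gbinom_ratio]. *)
Lemma gbinomC q i j : gbinom q i j = gbinom q j i.
Proof.
elim: i j => [|i IHi] j; first by rewrite gbinom0n gbinomn0.
elim: j => [|j IHj]; first by rewrite gbinom0n gbinomn0.
have := gbinom_ratio q i j; rewrite !gbinomSS -IHi -IHj => /eqP.
rewrite !mulrBl !mul1r subr_eq addrAC eq_sym subr_eq eq_sym => /eqP ->.
by rewrite addrC.
Qed.

(* This is "(-a; q)_n": the sign of [a] is opposite to the usual convention. *)
Definition qpoch q a n : K := \prod_(i < n) (1 + a * q ^+ i).

Lemma qpochS q a n : qpoch q a n.+1 = qpoch q a n * (1 + a * q ^+ n).
Proof. by rewrite /qpoch big_ord_recr. Qed.

Definition boulet_sum x a c n : K :=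
  \sum_(j < n.+1) gbinom (x ^+ 2) (n - j) j *
     (qpoch (x ^+ 2) a (n - j) * qpoch (x ^+ 2) c j * x ^+ j).

Lemma boulet_sum0 x a c : boulet_sum x a c 0 = 1.
Proof.
by rewrite /boulet_sum big_ord1 /qpoch !big_ord0 /= !mulr1.
Qed.

(** Reversing the swapped sum aligns the Gaussian binomials; the factor [a * x ^+ n] then becomes
    [a * (x ^+ 2) ^+ (n - j)], which lengthens [qpoch (x ^+ 2) a (n - j)] by one factor. *)
Lemma boulet_sum_half x a c n :
  boulet_sum x a c n + a * x ^+ n * boulet_sum x c a n =
  \sum_(j < n.+1) gbinom (x ^+ 2) (n - j) j *
     (qpoch (x ^+ 2) a (n.+1 - j) * qpoch (x ^+ 2) c j * x ^+ j).
Proof.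
rewrite [boulet_sum x c a n](reindex_inj rev_ord_inj) /= mulr_sumr -big_split.
apply: eq_bigr => -[j /=]; rewrite ltnS => le_jn _.
rewrite subSS subKn // gbinomC subSn // qpochS.
have -> : x ^+ n = x ^+ (n - j) * x ^+ j by rewrite -exprD subnK.
rewrite -(exprM x 2) mulnC exprM.
ring.
Qed.

Lemma boulet_sumS x a c n :
  boulet_sum x a c n.+1 =
  boulet_sum x a c n + a * x ^+ n * boulet_sum x c a n +
  x ^+ n.+1 * (boulet_sum x c a n + c * x ^+ n * boulet_sum x a c n).
Proof.
rewrite !boulet_sum_half [X in _ * X](reindex_inj rev_ord_inj) /= mulr_sumr.
(* The second half, reversed, carries [F j.+1] where the first carries [F j]; collecting equal [F]
   leaves exactly the q-Pascal rule. *)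
pose F j := qpoch (x ^+ 2) a (n.+1 - j) * qpoch (x ^+ 2) c j * x ^+ j.
have -> : \sum_(j < n.+1) x ^+ n.+1 *
    (gbinom (x ^+ 2) (n - (n.+1 - j.+1)) (n.+1 - j.+1) *
     (qpoch (x ^+ 2) c (n.+1 - (n.+1 - j.+1)) *
      qpoch (x ^+ 2) a (n.+1 - j.+1) * x ^+ (n.+1 - j.+1)))
  = \sum_(j < n.+1) (x ^+ 2) ^+ (n - j) * gbinom (x ^+ 2) (n - j) j * F j.+1.
  apply: eq_bigr => -[j /=]; rewrite ltnS => le_jn _.
  rewrite subSS subSn ?leq_subr // subKn // gbinomC /F subSS.
  have -> : x ^+ n.+1 = x ^+ (n - j) * x ^+ j.+1 by rewrite -exprD addnS subnK.
  by rewrite -(exprM x 2) mulnC exprM; ring.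
rewrite /boulet_sum big_ord_recl big_ord_recr /= [X in _ = X + _]big_ord_recl.
rewrite [X in _ = _ + X]big_ord_recr /= -!/(F _) !subn0 !subnn !gbinomn0.
rewrite !gbinom0n expr0 !mul1r -!addrA; congr (_ + _); rewrite !addrA.
congr (_ + _); rewrite -big_split; apply: eq_bigr => -[j /= lt_jn] _.
rewrite /bump leq0n /= add1n /F subSS -mulrDl; congr (_ * _).
by have -> : (n - j = (n - j.+1).+1)%N by lia.
Qed.

Lemma expr_eq0_le q m n : q ^+ m = 0 -> (m <= n)%N -> q ^+ n = 0.
Proof. by move=> q0 /subnK <-; rewrite exprD q0 mulr0. Qed.

Lemma qpoch_stable q a m n : q ^+ m = 0 -> (m <= n)%N ->
  qpoch q a n = qpoch q a m.
Proof.
move=> q0; elim: n => [|n IHn]; first by rewrite leqn0 => /eqP ->.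
rewrite leq_eqVlt => /orP[/eqP -> //|]; rewrite ltnS => le_mn.
by rewrite qpochS (expr_eq0_le q0 le_mn) mulr0 addr0 mulr1 IHn.
Qed.

Lemma qpoch_unit q n k : q ^+ n = 0 -> exists w, w * qpoch q (- q) k = 1.
Proof.
move=> q0; elim: k => [|k [w wD]].
  by exists 1; rewrite /qpoch big_ord0 mulr1.
pose z := q * q ^+ k; have z0 : z ^+ n = 0 by rewrite exprMn q0 mul0r.
exists (w * \sum_(i < n) z ^+ i); rewrite qpochS mulrACA wD mul1r.
rewrite mulNr -/z; move: z z0 => z z0.
by rewrite mulrC -opprB mulNr -subrX1 z0 sub0r opprK.
Qed.

(* Euler's theorem "distinct parts = odd parts", both sides evaluated in [x]. *)
Lemma euler_odd_distinct x n : x ^+ n = 0 ->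
  qpoch (x ^+ 2) (- x) n * (qpoch (x ^+ 2) x n * qpoch (x ^+ 2) (x ^+ 2) n) = 1.
Proof.
move=> x0; set q := x ^+ 2.
have q0 : q ^+ n = 0 by rewrite exprAC x0 expr0n.
have [w wD] := qpoch_unit n q0; set P := LHS.
(* The factors pair up to [1 - q ^+ (2 * i + 1)] and [1 - q ^+ (2 * i + 2)], which interleave on the
   right. At [k = n] nilpotency shortens the right side to [qpoch q (- q) n], a unit that
   cancels. *)
suff PD k : qpoch q (- x) k * (qpoch q x k * qpoch q q k) * qpoch q (- q) k =
    qpoch q (- q) (k + k).
  have := PD n; rewrite -/P (qpoch_stable _ q0) ?leq_addr // => PDn.
  by rewrite -[RHS]wD -[X in _ = _ * X]PDn mulrCA wD mulr1.
elim: k => [|k IHk]; first by rewrite /qpoch !big_ord0 !mulr1.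
rewrite addnS addSn !qpochS -IHk (exprS q) exprD.
by move: (qpoch _ _ _) (qpoch _ _ _) (qpoch _ _ _) (qpoch _ _ _) (q ^+ k);
  rewrite /q => *; ring.
Qed.

(** Here [b j] stands for 1/(q; q)_j, given by its recursion to avoid division. Coefficients of
    [y ^+ j] are compared; the term left over at the truncation carries [y ^+ n]. *)
Lemma qbinomial_shift q c y b n :
    (forall j, (j.+1 < n)%N -> (1 - q ^+ j.+1) * b j.+1 = b j) ->
    y ^+ n = 0 ->
  (1 - y) * (\sum_(j < n) qpoch q c j * b j * y ^+ j) =
  (1 + c * y) * (\sum_(j < n) qpoch q c j * b j * (y * q) ^+ j).
Proof.
case: n => [|n] bS y0; first by rewrite !big_ord0 !mulr0.
set S := (X in _ * X = _); set S' := (X in _ = _ * X).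
suff SB : S - S' = y * S + c * y * S'.
  apply/eqP; rewrite -subr_eq0.
  have -> : (1 - y) * S - (1 + c * y) * S' = S - S' - (y * S + c * y * S').
    by ring.
  by rewrite SB subrr.
rewrite /S /S' -sumrB big_ord_recl !expr0 subrr add0r.
rewrite !mulr_sumr -big_split /= [RHS]big_ord_recr /=.
rewrite [X in _ = _ + X](_ : _ =
    y ^+ n.+1 * (qpoch q c n * b n * (1 + c * q ^+ n))); last first.
  by rewrite exprMn exprS; ring.
rewrite y0 mul0r addr0; apply: eq_bigr => -[j /= lt_jn] _.
rewrite /bump leq0n add1n qpochS -(bS j) // !exprMn !exprS.
ring.
Qed.

(** Iterating the shift [m] times moves the argument to [x * q ^+ m = 0], where only the constant
    term survives. *)
Lemma qbinomial_theorem q c x b n m :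
    b 0%N = 1 ->
    (forall j, (j.+1 < n.+1)%N -> (1 - q ^+ j.+1) * b j.+1 = b j) ->
    x ^+ n.+1 = 0 -> q ^+ m = 0 ->
  qpoch q (- x) m * (\sum_(j < n.+1) qpoch q c j * b j * x ^+ j) =
  qpoch q (c * x) m.
Proof.
move=> b0 bS x0 q0.
suff shift k : qpoch q (- x) k * (\sum_(j < n.+1) qpoch q c j * b j * x ^+ j) =
    qpoch q (c * x) k *
      (\sum_(j < n.+1) qpoch q c j * b j * (x * q ^+ k) ^+ j).
  rewrite shift q0 mulr0 big_ord_recl big1 => [|j _].
    by rewrite addr0 /qpoch big_ord0 b0 !mulr1.
  by rewrite expr0n mulr0.
elim: k => [|k IHk]; first by rewrite /qpoch !big_ord0 !mul1r expr0 mulr1.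
rewrite qpochS mulrAC IHk qpochS -!mulrA; congr (_ * _).
rewrite mulrC mulNr (qbinomial_shift c bS); last by rewrite exprMn x0 mul0r.
by rewrite -[x * _ * q]mulrA -exprSr.
Qed.

(** Only [j <= n] contribute, and then [m - j >= n.+1]: [qpoch (x ^+ 2) a (m - j)] has stabilised,
    and the vanishing of [(x ^+ 2) ^+ (m - j)] turns [gbinom_ratio] into the recursion for [b]. *)
Lemma boulet_sum_product x a c n m : x ^+ n.+1 = 0 -> (n.+1.*2 <= m)%N ->
  boulet_sum x a c m = qpoch (x ^+ 2) a m * qpoch (x ^+ 2) (c * x) m *
    (qpoch (x ^+ 2) x m * qpoch (x ^+ 2) (x ^+ 2) m).
Proof.
move=> x0 le_nm; have xm0 : x ^+ m = 0 by apply: expr_eq0_le x0 _; lia.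
have q0 : (x ^+ 2) ^+ n.+1 = 0 by rewrite exprAC x0 expr0n.
have qm0 : (x ^+ 2) ^+ m = 0 by rewrite exprAC xm0 expr0n.
pose b j := gbinom (x ^+ 2) (m - j) j.
have -> : boulet_sum x a c m = qpoch (x ^+ 2) a m *
    (\sum_(j < n.+1) qpoch (x ^+ 2) c j * b j * x ^+ j).
  rewrite /boulet_sum mulr_sumr -(subnKC (_ : n.+1 <= m.+1)%N); last by lia.
  rewrite big_split_ord /= [X in _ + X]big1 ?addr0 => [|j _].
    apply: eq_bigr => -[j /= lt_jn] _.
    rewrite (qpoch_stable a q0 (_ : n.+1 <= m)%N); last by lia.
    by rewrite -(qpoch_stable a q0 (_ : n.+1 <= m - j)%N) ?/b; [ring | lia].
  by rewrite (expr_eq0_le x0 (leq_addr j n.+1)) !mulr0.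
rewrite -(@qbinomial_theorem (x ^+ 2) c x b n m) //; first last.
- move=> j lt_jn; have := gbinom_ratio (x ^+ 2) (m - j.+1) j.
  rewrite -/(b j.+1) => ->; have -> : ((m - j.+1).+1 = m - j)%N by lia.
  by rewrite (expr_eq0_le q0) ?subr0 ?mul1r //; lia.
- by rewrite /b gbinomn0.
rewrite -[RHS]mulrA; congr (_ * _).
by rewrite mulrAC euler_odd_distinct // mul1r.
Qed.

End QSeries.

(** * Enumeration of partitions into distinct parts *)

Fixpoint distinct_parts (n : nat) : seq (seq nat) :=
  if n is n'.+1 then
    distinct_parts n' ++ map (cons n) (distinct_parts n')
  else [:: [::]].

Lemma mem_distinct_parts n s :
  (s \in distinct_parts n) = sorted gtn s && all (fun x => 0 < x <= n) s.
Proof.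
elim: n s => [|n IHn] s /=.
  case: s => [//|x s] /=; rewrite inE /=; symmetry; apply/negbTE.
  by rewrite negb_and; apply/orP; right; case: x.
rewrite mem_cat IHn; case: s => [//|x s].
have -> : (x :: s \in map (cons n.+1) (distinct_parts n)) =
    (x == n.+1) && (s \in distinct_parts n).
  apply/mapP/andP => [[t t_in [-> ->]]|[/eqP -> s_in]] //.
  by exists s.
rewrite IHn /= !path_sortedE; last by move=> y z t /= ? ?; lia.
apply/idP/idP.
  case/orP => /and3P[].
    move=> /andP[/allP lt_s ss] xn /allP s_n; rewrite ss andbT.
    apply/and3P; split; [by apply/allP | by lia |].
    by apply/allP => y ys; have := s_n y ys; lia.
  move=> /eqP -> ss /allP s_n; rewrite ss andbT; apply/and3P; split.
  - by apply/allP => y ys; have /= := s_n y ys; lia.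
  - by lia.
  - by apply/allP => y ys; have := s_n y ys; lia.
case/and3P => /andP[/allP lt_s ss] xn /allP s_n; rewrite !ss /= andbT.
have [->|ne_xn] := eqVneq x n.+1; apply/orP; [right | left].
  by apply/allP => y ys; have /= := lt_s y ys; have /= := s_n y ys; lia.
apply/and3P; split; [by apply/allP | by lia |].
by apply/allP => y ys; have /= := lt_s y ys; have /= := s_n y ys; lia.
Qed.

Lemma distinct_parts_uniq n : uniq (distinct_parts n).
Proof.
elim: n => [//|n IHn] /=.
rewrite cat_uniq IHn map_inj_uniq; last by move=> s t [].
rewrite IHn andbT; apply/hasPn => _ /mapP[s _ ->] /=.
by rewrite mem_distinct_parts /= ltnn andbF.
Qed.

(** The freedom in [N] allows bounds on the parts that are multiples of 3 and of 6. *)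
Lemma num_partitions_count n N (P : pred (seq nat)) :
    (forall s, P s -> uniq s) -> n <= N ->
  num_partitions n P =
    count (fun s => (sumn s == n) && P s) (distinct_parts N).
Proof.
move=> P_uniq le_nN; rewrite /num_partitions cardE -size_filter.
have val_inj2 : injective (fun s : {bseq n of 'I_n.+1} => map val s).
  by move=> s t /(inj_map val_inj)/val_inj.
rewrite -(size_map (fun s : {bseq n of 'I_n.+1} => map val s)).
apply/perm_size/uniq_perm.
- by rewrite map_inj_uniq ?enum_uniq.
- by rewrite filter_uniq ?distinct_parts_uniq.
move=> s; rewrite mem_filter mem_distinct_parts.
have part_le t y : y \in t -> y <= sumn t.
  elim: t => [//|z t IHt] /=; rewrite in_cons => /orP[/eqP ->|/IHt]; lia.
apply/mapP/idP => [[t]|].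
  rewrite mem_enum inE => /andP[/and3P[ss s0 sn] Ps] ->.
  rewrite sn Ps /= gtn_sorted_uniq_geq P_uniq // ss /=.
  apply/allP => y ys; have := part_le _ _ ys; rewrite (eqP sn) => le_yn.
  by rewrite lt0n (leq_trans le_yn) // andbT; apply: contraNneq s0 => <-.
case/andP => /andP[sn Ps] /andP[ss /allP s_N].
have sp : is_partition n s.
  rewrite /is_partition sn; rewrite gtn_sorted_uniq_geq in ss.
  case/andP: ss => _ ->; rewrite andbT /=.
  by apply/negP => /s_N.
have [t [ts _]] := partition_bseq sp; exists t; last by [].
by rewrite mem_enum inE ts sp.
Qed.

(** * The conditions on parts as an alternating chain *)

Fixpoint alt_chain (b : bool) (s : seq nat) : bool :=
  if s is x :: s' then
    [&& x %% 3 != (if b then 1 else 2),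
        (if s' is y :: _ then y + b < x else true) & alt_chain (~~ b) s']
  else true.

Lemma alt_chain_sorted b s : alt_chain b s -> sorted gtn s.
Proof.
elim: s b => [//|x [//|y s] IHs] b /= /and3P[_ yx /IHs /= ->].
by rewrite andbT; lia.
Qed.

Lemma alt_chainP b s :
  reflect (forall j, j < size s ->
             nth 0 s j %% 3 != (if b (+) odd j then 1 else 2) /\
             (j.+1 < size s -> nth 0 s j.+1 + (b (+) odd j) < nth 0 s j))
          (alt_chain b s).
Proof.
apply: (iffP idP).
  elim: s b => [//|x s IHs] b /= /and3P[xb xs /IHs {}IHs] [_|j].
    by rewrite addbF; split=> //; case: s xs {IHs}.
  by rewrite ltnS => /IHs; rewrite addNb -addbN.
elim: s b => [//|x s IHs] b H /=; have [] := H 0 isT.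
rewrite /= addbF => -> xs /=.
apply/andP; split; first by case: s xs {H IHs} => //= y s; apply.
by apply: IHs => j js; have := H j.+1 js; rewrite /= addNb -addbN.
Qed.

(** The parts that avoid 1 modulo 3 are those needing a gap above 1, so one boolean encodes both
    conditions. They have odd index for [m = 1] and even index for [m = 2]. *)
Lemma A_cond_alt_chain m s : m = 1 \/ m = 2 ->
  A_cond m s = alt_chain (m == 1) s.
Proof.
move=> hm; apply/A_condP/alt_chainP => [H j js|H r i r2 ir].
  (* Position [j], counted from 0, is index [j.+1 = 2 * i + r] with [i = j.+1./2] and
     [r = odd j.+1]. *)
  have ej : 2 * j.+1./2 + odd j.+1 = j.+1.
    by rewrite mul2n addnC odd_double_half.
  have ej2 : 2 * j.+1./2 + 1 + odd j.+1 = j.+2 by rewrite addnAC ej addn1.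
  have [| |Hi Hii] := H (odd j.+1) j.+1./2; [by case: odd | by rewrite ej |].
  split=> [|js2].
    have := Hi; rewrite /A_cond_i /part ej => /(_ js) /=.
    by case: hm => -> /=; case: (odd j);
    rewrite ?subnn ?subSnn ?expr0 ?expr1 /=; lia.
  have := Hii; rewrite /A_cond_ii /part ej ej2 => /(_ js2) /=.
  by case: hm => -> /=; case: (odd j);
    rewrite ?subnn ?subSnn ?expr0 ?expr1 /=; lia.
rewrite /A_cond_i /A_cond_ii /part.
have [j ej] : exists j, 2 * i + r = j.+1 by exists (2 * i + r).-1; lia.
have -> : 2 * i + 1 + r = j.+2 by lia.
have er : r = ~~ odd j.
  have := congr1 odd ej; rewrite oddD oddM /=.
  by case: r r2 {ir ej} => [|[]] //= _ <-.
rewrite ej er /=; split=> hj; have [] := H j; try lia.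
  by case: hm => ->; case: (odd j);
    rewrite ?subnn ?subSnn ?expr0 ?expr1 /=; lia.
by move=> _ /(_ hj); case: hm => ->; case: (odd j);
    rewrite ?subnn ?subSnn ?expr0 ?expr1 /=; lia.
Qed.

(** * Generating functions of both families *)

Section GeneratingFunctions.
Local Open Scope ring_scope.
Variable K : comPzRingType.
Implicit Types (q : K) (P : pred (seq nat)).

Definition genfun q P n : K :=
  \sum_(s <- distinct_parts n | P s) q ^+ sumn s.

Lemma genfunS q P n :
  genfun q P n.+1 =
  genfun q P n + q ^+ n.+1 * genfun q (fun s => P (n.+1 :: s)) n.
Proof.
rewrite /genfun big_cat big_map mulr_sumr; congr (_ + _).
by apply: eq_bigr => s _; rewrite exprD.
Qed.

Lemma eq_genfun q P P' n :
  {in distinct_parts n, P =1 P'} -> genfun q P n = genfun q P' n.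
Proof.
move=> eqP'; rewrite /genfun big_seq_cond [RHS]big_seq_cond.
by apply: eq_bigl => s; have [/eqP' ->|] := boolP (s \in _).
Qed.

Lemma genfun_pred0 q P n :
  {in distinct_parts n, P =1 xpred0} -> genfun q P n = 0.
Proof. by move/eq_genfun => ->; rewrite /genfun big_pred0. Qed.

Lemma genfun_alt_chain0 q b : genfun q (alt_chain b) 0 = 1.
Proof. by rewrite /genfun big_cons big_nil /= expr0 addr0. Qed.

Lemma genfun_alt_chain_skip q (b : bool) n :
    (n.+1 %% 3 = (if b then 1 else 2))%N ->
  genfun q (alt_chain b) n.+1 = genfun q (alt_chain b) n.
Proof.
move=> nb; rewrite genfunS [X in _ * X]genfun_pred0 ?mulr0 ?addr0 // => s _.
by rewrite /= nb eqxx.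
Qed.

Lemma genfun_alt_chain_false q n : (n.+1 %% 3 != 2)%N ->
  genfun q (alt_chain false) n.+1 =
  genfun q (alt_chain false) n + q ^+ n.+1 * genfun q (alt_chain true) n.
Proof.
move=> nb; rewrite genfunS; congr (_ + _ * _); apply: eq_genfun => s.
rewrite mem_distinct_parts /= nb /=.
by case: s => [//|y s] /andP[_ /= /andP[/andP[_ yn] _]]; rewrite addn0 ltnS yn.
Qed.

(** The gap after the part [n.+2] rules out [n.+1], so the tail has parts at most [n]. *)
Lemma genfun_alt_chain_true q n : (n.+2 %% 3 != 1)%N ->
  genfun q (alt_chain true) n.+2 =
  genfun q (alt_chain true) n.+1 + q ^+ n.+2 * genfun q (alt_chain false) n.
Proof.
move=> nb; rewrite genfunS; congr (_ + _ * _).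
rewrite genfunS [X in _ + _ * X]genfun_pred0 ?mulr0 ?addr0; last first.
  by move=> s _; rewrite /= addn1 ltnn andbF.
apply: eq_genfun => s; rewrite mem_distinct_parts /= nb /=.
by case: s => [//|y s] /andP[_ /= /andP[/andP[_ yn] _]]; rewrite addn1 !ltnS yn.
Qed.

Lemma genfun_alt_chain q n :
  genfun q (alt_chain true) (3 * n) = boulet_sum (q ^+ 3) (q ^+ 2) q n /\
  genfun q (alt_chain false) (3 * n) = boulet_sum (q ^+ 3) q (q ^+ 2) n.
Proof.
elim: n => [|n [IHt IHf]].
  by rewrite muln0 !genfun_alt_chain0 !boulet_sum0.
have -> : (3 * n.+1 = (3 * n).+3)%N by lia.
rewrite !boulet_sumS -IHt -IHf.
rewrite (genfun_alt_chain_true q (n := (3 * n).+1)); last by lia.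
rewrite (genfun_alt_chain_true q (n := 3 * n)); last by lia.
rewrite (genfun_alt_chain_skip q (b := true) (n := 3 * n)); last by lia.
rewrite (genfun_alt_chain_false q (n := (3 * n).+2)); last by lia.
rewrite (genfun_alt_chain_skip q (b := false) (n := (3 * n).+1)); last by lia.
rewrite (genfun_alt_chain_false q (n := 3 * n)); last by lia.
rewrite (genfun_alt_chain_true q (n := 3 * n)); last by lia.
rewrite (genfun_alt_chain_skip q (b := true) (n := 3 * n)); last by lia.
have -> : (q ^+ 3) ^+ n.+1 = q ^+ 3 * q ^+ (3 * n) by rewrite exprS -exprM.
by rewrite -(exprM q 3) !exprS; split; ring.
Qed.

Lemma genfun_all q (p : pred nat) n :
  genfun q (all p) n = \prod_(i < n) (1 + (if p i.+1 then q ^+ i.+1 else 0)).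
Proof.
elim: n => [|n IHn]; first by rewrite big_ord0 /genfun big_cons big_nil addr0.
rewrite big_ord_recr /= -IHn genfunS mulrDr mulr1; congr (_ + _).
have [pn|pn] := boolP (p n.+1).
  by rewrite mulrC; congr (_ * _); apply: eq_genfun => s _ /=; rewrite pn.
rewrite genfun_pred0 ?mulr0 // => s _ /=.
by rewrite (negbTE pn).
Qed.

(** Each of the four products collects one admissible residue class modulo 6: 2, 4, 3, 0 for [m = 1]
    and 1, 5, 3, 0 for [m = 2]. *)
Lemma genfun_C_cond q m n : (m = 1 \/ m = 2)%N ->
  genfun q (C_cond m) (6 * n) =
  qpoch ((q ^+ 3) ^+ 2) (if m == 1%N then q ^+ 2 else q) n *
  qpoch ((q ^+ 3) ^+ 2) ((if m == 1%N then q else q ^+ 2) * q ^+ 3) n *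
  (qpoch ((q ^+ 3) ^+ 2) (q ^+ 3) n *
   qpoch ((q ^+ 3) ^+ 2) ((q ^+ 3) ^+ 2) n).
Proof.
move=> hm; set p := fun x : nat =>
  (x%:Z != m%:Z %[mod 6])%Z && (x%:Z != - m%:Z %[mod 6])%Z.
rewrite (@eq_genfun _ _ (all p)); last first.
  move=> s; rewrite mem_distinct_parts gtn_sorted_uniq_geq.
  by rewrite /C_cond => /andP[/andP[-> _] _].
rewrite genfun_all; elim: n => [|n IHn].
  by rewrite muln0 /qpoch !big_ord0 !mulr1.
have -> : (6 * n.+1 = (6 * n).+4.+2)%N by lia.
rewrite !big_ord_recr /= {}IHn !qpochS -(exprM q 3) -(exprM q _ n).
have -> : (3 * 2 = 6)%N by [].
case: hm => m_eq; rewrite m_eq /=.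
  have [-> -> -> [-> -> ->]] : [/\ p (6 * n).+1 = false, p (6 * n).+2 = true,
    p (6 * n).+3 = true & [/\ p (6 * n).+4 = true, p (6 * n).+4.+1 = false
    & p (6 * n).+4.+2 = true]] by split; [..|split]; rewrite /p m_eq; lia.
  by rewrite !exprS; ring.
have [-> -> -> [-> -> ->]] : [/\ p (6 * n).+1 = true, p (6 * n).+2 = false,
  p (6 * n).+3 = true & [/\ p (6 * n).+4 = false, p (6 * n).+4.+1 = true
  & p (6 * n).+4.+2 = true]] by split; [..|split]; rewrite /p m_eq; lia.
by rewrite !exprS; ring.
Qed.

End GeneratingFunctions.

(** * Coefficient extraction modulo ['X^(n.+1)] *)

Section Coefficients.
Local Open Scope ring_scope.

Lemma coef_genfun P N n :
  (genfun ('X : {poly int}) P N)`_n =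
  (count (fun s => (sumn s == n) && P s) (distinct_parts N))%:R.
Proof.
rewrite /genfun coef_sum -sum1_count natr_sum [RHS]big_mkcondl /=.
by apply: eq_bigr => s _; rewrite coefXn eq_sym; case: eqP.
Qed.

Lemma rmorph_genfun (K L : comPzRingType) (f : {rmorphism K -> L}) q P N :
  f (genfun q P N) = genfun (f q) P N.
Proof. by rewrite rmorph_sum; apply: eq_bigr => s _; rewrite rmorphXn. Qed.

Lemma coef_in_qpolyXn (p r : {poly int}) n :
  in_qpoly 'X^(n.+1) p = in_qpoly 'X^(n.+1) r -> p`_n = r`_n.
Proof.
have Xmonic := monicXn int n.+1.
move=> /(congr1 val) /=; rewrite mk_monic_Xn /= => eq_mod.
suff coef_mod (s : {poly int}) : s`_n = (Pdiv.Ring.rmodp s 'X^(n.+1))`_n.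
  by rewrite coef_mod eq_mod -coef_mod.
by rewrite {1}(Pdiv.RingMonic.rdivp_eq Xmonic s) coefD coefMXn ltnSn add0r.
Qed.

Lemma in_qpolyX_nilp n :
  (in_qpoly ('X^(n.+1) : {poly int}) 'X) ^+ n.+1 = 0.
Proof.
rewrite -rmorphXn /=; apply/val_inj; rewrite /= mk_monic_Xn /=.
exact: Pdiv.RingMonic.rmodpp (monicXn _ _).
Qed.

End Coefficients.

Theorem theorem3 (m n : nat) (hm : m = 1 \/ m = 2) : A m n = C m n.
Proof.
(* This is the threshold of [boulet_sum_product]. Parts up to [3 * N] give a Boulet sum of index
   [N], and parts up to [6 * N] give products of length [N]. *)
pose N := n.+1.*2.
rewrite /A /C (@num_partitions_count n (3 * N)); first last.
- by rewrite /N; lia.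
- move=> s; rewrite A_cond_alt_chain // => /alt_chain_sorted.
  by rewrite gtn_sorted_uniq_geq => /andP[].
rewrite (@num_partitions_count n (6 * N)); first last.
- by rewrite /N; lia.
- by move=> s /andP[].
apply/eqP; rewrite -(Num.Theory.eqr_nat int) -!coef_genfun.
apply/eqP/coef_in_qpolyXn.
rewrite !rmorph_genfun /=; set q := in_qpoly _ 'X.
have x0 : ((q ^+ 3) ^+ n.+1 = 0)%R by rewrite exprAC in_qpolyX_nilp expr0n.
rewrite (@eq_genfun _ _ _ (alt_chain (m == 1))); last first.
  by move=> s _; apply: A_cond_alt_chain.
have [gt gf] := genfun_alt_chain q N.
rewrite genfun_C_cond //.
by case: hm => -> /=; rewrite ?gt ?gf (boulet_sum_product _ _ x0).
Qed.
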